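(* Let $K$ be a prime link diagram without curls, let $i\in K_1$ be a segment of $K$, and let $T(i)$ be the associated representation of the quiver $Q$ of $K$ over the algebraically closed field $\Bbbk$. Then the poset of all submodules (subrepresentations) of $T(i)$, ordered by inclusion, is a finite distributive lattice.
   Context: Link diagrams. A link diagram $K$ is a projection of a link to the plane that is injective except for finitely many transversal double points (crossing points). It is regarded as a cellular decomposition of the oriented sphere $S^2$: $K_0$ is the set of crossing points (nonempty), $K_1$ the set of segments (edges; every crossing point is incident to four segments and every segment to two crossing points), $K_2$ the set of regions of the complement; $|K_1|=2|K_0|$ and $|K_2|=|K_0|+2$ (so $K$ is connected). A curl is a monogon region; $K$ is without curls if it has no monogon. ''Prime link diagram'' means: the link is prime (not the connected sum of two nontrivial links), and the diagram is prime, i.e. every simple closed curve in $S^2$ meeting $K$ transversally in exactly two points, both interior points of segments, bounds on one side a disc containing no crossing points. ''Clockwise'' is with respect to the fixed orientation of the plane. Kauffman states. Let $i\in K_1$, with adjacent regions $R_i,R_i'$. A marker is a pair $(x,R)$ with $x\in K_0$, $R\in K_2$, $x$ incident to $R$. A Kauffman state relative to $i$ is a set of markers such that each crossing point is used in exactly one marker, each region other than $R_i,R_i'$ is used in exactly one marker, and $R_i,R_i'$ are used in no marker. Let $j$ be a segment with endpoints $x,y$ and adjacent regions $R_1,R_2$ such that going clockwise around $x$ one passes from $R_1$ to $R_2$ when crossing $j$. A state $\mathcal S'$ is obtained from $\mathcal S$ by a counterclockwise transposition at $j$ if $\mathcal S$ contains $(x,R_2),(y,R_1)$, $\mathcal S'$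 contains $(x,R_1),(y,R_2)$, and all other markers agree. Put $\mathcal S_1<\mathcal S_2$ if a (nonempty) sequence of counterclockwise transpositions transforms $\mathcal S_1$ into $\mathcal S_2$. This is a partial order with a unique minimal and a unique maximal element (Kauffman). The quiver $Q$. Its vertices are the segments, $Q_0=K_1$. For every crossing point with segments $a_1,a_2,a_3,a_4$ in clockwise order draw arrows $a_1\to a_2\to a_3\to a_4\to a_1$; then remove all 2-cycles. Each remaining arrow $\alpha:j\to k$ corresponds to a position $(x,R)$ in the diagram: the region $R$ at the crossing point $x$ lying between $j$ and the next segment $k$ in clockwise direction. The representation $T(i)=(T(i)_j,\phi_\alpha)$. For $j\in K_1$ let $d_j=\dim T(i)_j$ be the number of transpositions at $j$ in any sequence of counterclockwise transpositions from the minimal to the maximal Kauffman state relative to $i$ (this number does not depend on the sequence). $T(i)_j$ is the $\Bbbk$-vector space with basis $B(i)_j=\{b_{j,1},\dots,b_{j,d_j}\}$. For every arrow $\alpha:j\to k$ one has $|d_j-d_k|\le 1$, and $\phi_\alpha:T(i)_j\to T(i)_k$ is given by: - if $d_k=d_j+1$: $\phi_\alpha(b_{j,m})=b_{k,m}$ for all $m$; - if $d_k=d_j-1$: $\phi_\alpha(b_{j,m})=b_{k,m-1}$ for $m\ge2$ and $\phi_\alpha(b_{j,1})=0$; - if $d_k=d_j$ and the position $(x,R)$ corresponding to $\alpha$ is a marker of the minimal Kauffman state: $\phi_\alpha(b_{j,m})=b_{k,m-1}$ for $m\ge2$ and $\phi_\alpha(b_{j,1})=0$ (nilpotent Jordan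 block); - if $d_k=d_j$ and $(x,R)$ is not a marker of the minimal Kauffman state: $\phi_\alpha(b_{j,m})=b_{k,m}$ for all $m$ (identity). A subrepresentation (submodule) $L$ of $T(i)$ is a family of subspaces $L_j\subset T(i)_j$ with $\phi_\alpha(L_j)\subset L_k$ for all arrows $\alpha:j\to k$. *)

(* Defs.v *)
From HB Require Import structures.
From mathcomp Require Import all_boot all_order all_fingroup all_algebra.
From Stdlib Require Import Relations.

Set Implicit Arguments.
Unset Strict Implicit.
Unset Printing Implicit Defensive.

(* A 4-valent graph on the oriented sphere is encoded by its finite set of    *)
(* darts (ends of segments at crossing points): [cw] sends a dart to the next *)
(* dart clockwise around its crossing point, [opp] to the other end of its    *)
(* segment.  A dart x also names the corner between x and [cw x]; [under]     *)
(* holds the darts of the lower strands.  For the sake of the Reidemeister    *)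
(* calculus below, [cw]-orbits of size 2, i.e., points subdividing a segment, *)
(* are allowed as well.                                                       *)
Record pmap := PMap {
  dart :> finType;
  cw : {perm dart};
  opp : {perm dart};
  under : {set dart}
}.
Arguments cw {p}.
Arguments opp {p}.
Arguments under {p}.

(* Keeping a region on the right, one goes from the corner of x along x to    *)
(* the other end of the segment; the next corner of the region there is the   *)
(* one on the counterclockwise side of [opp x].                               *)
Definition bnd {M : pmap} : {perm M} := (opp * cw^-1)%g.

Definition adj {M : pmap} : rel M := [rel x y | (y == cw x) || (y == opp x)].

Lemma mem_porbits (T : finType) (s : {perm T}) (x : T) :
  porbit s x \in porbits s.
Proof. by apply/imsetP; exists x. Qed.

Section PlaneMap.
Variable M : pmap.

Definition crossing := {A : {set M} | A \in porbits (@cw M)}.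
Definition segment := {A : {set M} | A \in porbits (@opp M)}.
Definition region := {A : {set M} | A \in porbits (@bnd M)}.

Definition crossing_of (x : M) : crossing :=
  exist _ (porbit cw x) (mem_porbits cw x).
Definition segment_of (x : M) : segment :=
  exist _ (porbit opp x) (mem_porbits opp x).
Definition region_of (x : M) : region :=
  exist _ (porbit bnd x) (mem_porbits bnd x).

(* Each connected component of the graph has Euler characteristic 2.          *)
Definition plane_map : Prop :=
  [/\ forall x : M, opp (opp x) = x /\ opp x != x,
      forall x : M, #|porbit cw x| = 2 \/ #|porbit cw x| = 4,
      forall x : M, #|porbit cw x| = 4 -> (cw x \in under) = (x \notin under) &
      #|{: crossing}| + #|{: region}| = #|{: segment}| + 2 * n_comp adj M].

End PlaneMap.

Record link_diagram := LinkDiagram {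
  diagram_map :> pmap;
  _ : 0 < #|diagram_map|;
  _ : forall x : diagram_map, opp (opp x) = x /\ opp x != x;
  _ : forall x : diagram_map, #|porbit cw x| = 4;
  _ : forall x : diagram_map, (cw x \in under) = (x \notin under);
  _ : forall x y : diagram_map, connect adj x y;
  _ : #|{: region diagram_map}| = #|{: crossing diagram_map}| + 2
}.

(* Link types.  A link is given by a planar diagram code: labels name the     *)
(* segments, [:: a; b; c; d] is a crossing with ends a, b, c, d in clockwise  *)
(* order and lower strand a - c, and [:: a; b] is a point joining the         *)
(* segments a and b.                                                          *)
Definition code := seq (seq nat).

Definition presents (M : pmap) (P : code) : Prop :=
  exists (lab : M -> nat) (s : seq M),
    [/\ forall x y, lab x = lab y <-> y = x \/ y = opp x,
        forall x, count (mem (porbit cw x)) s = 1,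
        forall z, z \in s -> #|porbit cw z| = 4 -> z \in under &
        P = [seq [seq lab x | x <- fingraph.orbit cw z] | z <- s]].

Definition planar (P : code) : Prop :=
  exists M : pmap, plane_map M /\ presents M P.

(* Between planar codes the faces of the triangles, bigons and monogons below *)
(* are discs, so that the rules are genuine Reidemeister moves.  In the third *)
(* move the strands t, m, b are the top, middle and bottom one; the ends      *)
(* around the disc are, clockwise, t1 m1 b1 t3 m3 b3 in the first version and *)
(* t1 b1 m1 t3 b3 m3 in the second one.                                       *)
Inductive link_move : code -> code -> Prop :=
| Reorder P Q : perm_eq P Q -> link_move P Q
| Rot2 a b P : link_move ([:: a; b] :: P) ([:: b; a] :: P)
| Rot4 a b c d P : link_move ([:: a; b; c; d] :: P) ([:: c; d; a; b] :: P)
| Join a b P : a != b ->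
    link_move ([:: a; b] :: P)
              [seq [seq if c == b then a else c | c <- v] | v <- P]
| R1a a b c P : link_move ([:: a; a; b; c] :: P) ([:: b; c] :: P)
| R1b a b c P : link_move ([:: c; a; a; b] :: P) ([:: c; b] :: P)
| R2 e f p q r s P :
    link_move ([:: f; e; p; q] :: [:: f; r; s; e] :: P)
              ([:: p; s] :: [:: q; r] :: P)
| R3a t1 t2 t3 m1 m2 m3 b1 b2 b3 P :
    link_move ([:: m1; t2; m2; t1] :: [:: b1; t3; b2; t2] :: [:: b2; m3; b3; m2] :: P)
              ([:: m2; t3; m3; t2] :: [:: b2; t2; b3; t1] :: [:: b1; m2; b2; m1] :: P)
| R3b t1 t2 t3 m1 m2 m3 b1 b2 b3 P :
    link_move ([:: m1; t3; m2; t2] :: [:: b1; t2; b2; t1] :: [:: b2; m2; b3; m3] :: P)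
              ([:: m2; t2; m3; t1] :: [:: b2; t3; b3; t2] :: [:: b1; m1; b2; m2] :: P).

Definition same_link : code -> code -> Prop :=
  clos_refl_sym_trans code (fun P Q => [/\ planar P, planar Q & link_move P Q]).

Definition trivial_link (P : code) : Prop := same_link P [:: [:: 0; 0]].

(* Both codes are cut open at a subdividing point and glued.  Exchanging b    *)
(* and b' (Rot2) yields the gluing with the other orientation.                *)
Inductive connected_sum : code -> code -> code -> Prop :=
| ConnectedSum a a' b b' P1 P2 :
    ~~ has (mem (flatten ([:: a; a'] :: P1))) (flatten ([:: b; b'] :: P2)) ->
    connected_sum ([:: a; a'] :: P1) ([:: b; b'] :: P2)
                  ([:: a; b] :: [:: a'; b'] :: P1 ++ P2).

Definition prime_link (P : code) : Prop :=
  ~ exists P1 P2 P3 : code,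
      [/\ planar P1 /\ ~ trivial_link P1, planar P2 /\ ~ trivial_link P2,
          connected_sum P1 P2 P3 & same_link P P3].

(* Prime diagrams.  Regions being open discs, a simple closed curve meeting   *)
(* the diagram transversally in two points is determined up to isotopy by the *)
(* darts x, y whose segments it crosses, in each case leaving the region on   *)
(* the clockwise side of the dart for the one on its counterclockwise side.   *)
Definition two_point_curve (M : pmap) (x y : M) : Prop :=
  region_of (opp x) = region_of y /\ region_of (opp y) = region_of x.

(* A disc bounded by such a curve contains no crossing point iff it meets the *)
(* diagram in a single arc inside one segment, i.e., the curve comes back     *)
(* through the segment it has just crossed: if it crosses two different       *)
(* segments, each of these has an end on either side.                         *)
Definition bounds_crossing_free_disc (M : pmap) (x y : M) : Prop := y = opp x.

Definition prime_diagram (M : pmap) : Prop :=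
  forall x y : M, two_point_curve x y -> bounds_crossing_free_disc x y.

Definition prime_link_diagram (K : link_diagram) : Prop :=
  (forall P, presents K P -> prime_link P) /\ prime_diagram K.

(* A curl is a region with a single corner.                                   *)
Definition without_curls (K : link_diagram) : Prop :=
  forall R : region K, #|val R| != 1.

Section KauffmanStates.
Variables (K : link_diagram) (i : segment K).

Definition incident (x : crossing K) (R : region K) : bool :=
  [exists a : K, (crossing_of a == x) && (region_of a == R)].

Definition adjacent (j : segment K) (R : region K) : bool :=
  [exists a : K, (segment_of a == j) && (region_of a == R)].

Definition marker := (crossing K * region K)%type.

Definition kauffman_state (S : {set marker}) : bool :=
  [&& [forall m in S, incident m.1 m.2],
      [forall x, #|[set m in S | m.1 == x]| == 1] &
      [forall R, #|[set m in S | m.2 == R]| == (~~ adjacent i R : nat)]].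

(* At the crossing point of a dart a, going clockwise across its segment      *)
(* leads from R1 = [region_of (opp a)] to R2 = [region_of a].                 *)
Definition ccw_transposition (j : segment K) (S S' : {set marker}) : Prop :=
  kauffman_state S /\ kauffman_state S' /\
  exists a : K,
    let x := crossing_of a in let y := crossing_of (opp a) in
    let R1 := region_of (opp a) in let R2 := region_of a in
    [/\ segment_of a = j,
        (x, R2) \in S /\ (y, R1) \in S,
        (x, R1) \in S' /\ (y, R2) \in S' &
        S :\: [set (x, R2); (y, R1)] = S' :\: [set (x, R1); (y, R2)]].

(* [ccw_sequence S w S']: counterclockwise transpositions at the successive   *)
(* segments of w transform S into S'.                                         *)
Fixpoint ccw_sequence (S : {set marker}) (w : seq (segment K))
    (S' : {set marker}) : Prop :=
  if w is j :: w' then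
    exists2 S1, ccw_transposition j S S1 & ccw_sequence S1 w' S'
  else S = S'.

Definition state_lt (S S' : {set marker}) : Prop :=
  exists2 w, w != [::] & ccw_sequence S w S'.

Definition minimal_state (S : {set marker}) : Prop :=
  kauffman_state S /\ forall S', ~ state_lt S' S.

Definition maximal_state (S : {set marker}) : Prop :=
  kauffman_state S /\ forall S', ~ state_lt S S'.

End KauffmanStates.

Record quiver := Quiver {
  vertex : finType;
  arrow : finType;
  source : arrow -> vertex;
  target : arrow -> vertex
}.

(* Matrices act on row vectors from the right.                                *)
Record representation (F : fieldType) (Q : quiver) := Representation {
  rdim : vertex Q -> nat;
  rmap : forall a : arrow Q, 'M[F]_(rdim (source a), rdim (target a))
}.

Section Submodules.
Variables (F : fieldType) (Q : quiver) (T : representation F Q).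

Definition subspaces := {dffun forall j : vertex Q, {vspace 'rV[F]_(rdim T j)}}.

Definition is_submodule (L : subspaces) : bool :=
  [forall a : arrow Q,
     (linfun (mulmxr (rmap T a)) @: L (source a) <= L (target a))%VS].

Definition submodule := {L : subspaces | is_submodule L}.

Definition submodule_le (L N : submodule) : bool :=
  [forall j, (val L j <= val N j)%VS].

End Submodules.

Definition finite_distributive_lattice (X : Type) (le : rel X) : Prop :=
  exists (disp : Order.disp_t) (D : finDistrLatticeType disp) (f : X -> D),
    bijective f /\ forall x y, (f x <= f y)%O = le x y.

Section KauffmanModule.
Variable K : link_diagram.

(* The dart a stands for the arrow from its segment to the clockwise next one *)
(* at the same crossing point, with position given by the corner of a.  For a *)
(* prime diagram without curls there are no parallel arrows, so that removing *)
(* the 2-cycles amounts to removing all arrows lying on one.                  *)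
Definition on_two_cycle (a : K) : bool :=
  [exists b : K, (segment_of b == segment_of (cw a))
                 && (segment_of (cw b) == segment_of a)].

Definition quiver_arrow := {a : K | ~~ on_two_cycle a}.

Definition diagram_quiver : quiver :=
  @Quiver (segment K) quiver_arrow
    (fun a => segment_of (val a)) (fun a => segment_of (cw (val a))).

Variables (F : fieldType) (Smin : {set marker K}) (d : segment K -> nat).

(* The map at a sends b_{j,m} to b_{k,m - shift a}, and to 0 if m <= shift a. *)
Definition shift (a : K) : nat :=
  let dj := d (segment_of a) in let dk := d (segment_of (cw a)) in
  if dk == dj.+1 then 0
  else if dk.+1 == dj then 1
  else if (crossing_of a, region_of a) \in Smin then 1 else 0.

Definition kauffman_module : representation F diagram_quiver :=
  @Representation F diagram_quiver d
    (fun a => \matrix_(m, n) (m == n + shift (val a) :> nat)%N%:R)%R.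

End KauffmanModule.

(* Main.v *)
(* A transposition at j moves one marker across j at either end, so           *)
(* d_k - d_j = [a in Smax] - [a in Smin] for the corner a between a segment j *)
(* and the clockwise next one k; hence the map of the arrow a shifts the      *)
(* basis by [a in Smin].  If d_j >= 2 then no region of j is adjacent to i,   *)
(* since d vanishes around the regions of i; each such region has exactly one *)
(* marker in Smin, and composing the arrows along its boundary gives a full   *)
(* nilpotent Jordan block on T_j.  The arrows are available unless the region *)
(* is a bigon, and both regions of j are bigons only for the Hopf link, where *)
(* d <= 1.  So every submodule is spanned by basis vectors, and submodules    *)
(* amount to sets of basis vectors closed under the arrows.                   *)
From HB Require Import structures.
From mathcomp Require Import all_boot all_order all_fingroup all_algebra zify.
Require Import Defs.

Set Implicit Arguments.
Unset Strict Implicit.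
Unset Printing Implicit Defensive.

Import Order.TTheory Order.DefaultSetSubsetOrder GRing.Theory.
Local Open Scope ring_scope.

(** Submodules spanned by basis vectors correspond to sets of basis vectors closed under the nonzero
    matrix entries. Such sets form a sublattice of a finite power set, hence a finite distributive
    lattice ([submodules_distributive]). It remains to see that every L_j is spanned by basis
    vectors. A subspace invariant under one nilpotent Jordan block has this property
    ([shift_closed_coordinates]), so it suffices to produce the block on T_j from arrows. Each arrow
    shifts by its marker bit in [Smin] ([shiftE]), and a region not adjacent to i carries exactly
    one marker, so a full turn around it shifts by one ([in_submodule_region]). For d_j <= 1 this
    shift is zero anyway. For d_j >= 2 neither region of j is adjacent to i ([count_adjacent_i]),
    and by [two_bigons_count] one of them is not a bigon, so that all its arrows survive the removal
    of 2-cycles. *)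

Section ClosedSets.

(** * The distributive lattice of closed subsets *)

Variables (T : finType) (r : rel T).

Definition is_closed : pred {set T} :=
  fun A => [forall x in A, forall y, r x y ==> (y \in A)].

Lemma is_closedP (A : {set T}) :
  reflect (forall x y, x \in A -> r x y -> y \in A) (is_closed A).
Proof.
apply: (iffP forall_inP) => [clA x y /clA/forallP/(_ y)/implyP // | clA x Ax].
by apply/forallP => y; apply/implyP; apply: clA.
Qed.

Definition closed_set := {A : {set T} | is_closed A}.
HB.instance Definition _ := SubChoice.on closed_set.
HB.instance Definition _ := Finite.on closed_set.

Lemma is_closedI : Order.ClosedPredicates.meet_closed is_closed.
Proof.
move=> A B /is_closedP clA /is_closedP clB; apply/is_closedP => x y.
by rewrite !inE => /andP[/clA Ax /clB Bx] rxy; apply/andP; split; auto.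
Qed.

Lemma is_closedU : Order.ClosedPredicates.join_closed is_closed.
Proof.
move=> A B /is_closedP clA /is_closedP clB; apply/is_closedP => x y.
by rewrite !inE => /orP[/clA Ax | /clB Bx] rxy; apply/orP; auto.
Qed.

HB.instance Definition _ :=
  Order.SubChoice_isSubLattice.Build _ {set T} is_closed (Order.Disp tt tt)
    closed_set is_closedI is_closedU.

Lemma closed_meetUl :
  left_distributive (@Order.meet _ closed_set) (@Order.join _ closed_set).
Proof. by move=> A B C; apply: val_inj; exact: setIUl. Qed.

HB.instance Definition _ :=
  Order.Lattice_Meet_isDistrLattice.Build _ closed_set closed_meetUl.

Lemma closed_leE (A B : closed_set) : (A <= B)%O = (val A \subset val B).
Proof. by []. Qed.

End ClosedSets.

(** * Submodules spanned by basis vectors *)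

Section Submodules.
Variables (F : fieldType) (Q : quiver) (T : representation F Q).
Implicit Types (L N : submodule T) (j : vertex Q) (a : arrow Q).

Definition basis_index := {j : vertex Q & 'I_(rdim T j)}.
Definition basis_at j (m : 'I_(rdim T j)) : basis_index :=
  Tagged (fun l => 'I_(rdim T l)) m.

Definition basis_arrow : rel basis_index := fun p q =>
  [exists a : arrow Q, exists m, exists n,
    [&& p == basis_at m, q == basis_at n & rmap T a m n != 0]].

Definition basis_of_submodule L : {set basis_index} :=
  [set p | delta_mx 0 (tagged p) \in val L (tag p)].

Lemma submodule_map L a (v : 'rV_(rdim T (source a))) :
  v \in val L (source a) -> v *m rmap T a \in val L (target a).
Proof.
move=> Lv; have /forallP/(_ a)/subvP := valP L; apply.
by apply/memv_imgP; exists v; rewrite ?lfunE.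
Qed.

Hypothesis coordinates : forall L j (v : 'rV_(rdim T j)) m,
  v \in val L j -> v 0 m != 0 -> delta_mx 0 m \in val L j.

Lemma basis_of_submodule_closed L : is_closed basis_arrow (basis_of_submodule L).
Proof.
apply/is_closedP => p q; rewrite !inE => Lp.
case/existsP=> a /existsP[m /existsP[n /and3P[/eqP pm /eqP -> Tmn]]].
move: Lp; rewrite pm /= => /submodule_map; rewrite -rowE => /coordinates.
by apply; rewrite mxE.
Qed.

(** Encoded as the kernel of the projection onto the coordinates outside [A]. *)
Definition coordinate_subspaces (A : {set basis_index}) : subspaces T :=
  [ffun j => lker (linfun (mulmxr
     (diag_mx (\row_(m < rdim T j)
        (basis_at m \notin A)%:R : 'rV[F]_(rdim T j)))))].

Lemma coordinate_subspacesP (A : {set basis_index}) j (v : 'rV_(rdim T j)) :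
  reflect (forall m, v 0 m != 0 -> basis_at m \in A)
          (v \in coordinate_subspaces A j).
Proof.
rewrite ffunE memv_ker lfunE /= mul_mx_diag.
apply: (iffP eqP) => [v0 m vm | vA].
  move/rowP/(_ m)/eqP: v0; rewrite !mxE mulf_eq0 (negPf vm) /=.
  by case: (_ \in A) => //=; rewrite oner_eq0.
apply/rowP => m; rewrite !mxE.
by have [-> | /vA -> /=] := eqVneq (v 0 m) 0; rewrite ?mul0r ?mulr0.
Qed.

Lemma coordinate_subspaces_submodule (A : {set basis_index}) :
  is_closed basis_arrow A -> is_submodule (coordinate_subspaces A).
Proof.
move=> /is_closedP clA; apply/forallP => a; apply/subvP => _ /memv_imgP[v Av ->].
rewrite lfunE /=; apply/coordinate_subspacesP => n; rewrite mxE => vTn.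
have [m vTm] : exists m, v 0 m * rmap T a m n != 0.
  apply/existsP; apply: contraNT vTn; rewrite negb_exists => /forallP vT0.
  by rewrite big1 // => m _; apply/eqP; rewrite -[_ == _]negbK.
move: vTm; rewrite mulf_eq0 negb_or => /andP[vm Tmn].
apply: clA (elimT (coordinate_subspacesP A v) Av m vm) _.
apply/existsP; exists a; apply/existsP; exists m; apply/existsP; exists n.
by rewrite !eqxx.
Qed.

Lemma submodules_distributive : finite_distributive_lattice (@submodule_le F Q T).
Proof.
pose f L : closed_set basis_arrow :=
  exist (fun A => is_closed basis_arrow A) _ (basis_of_submodule_closed L).
pose g (A : closed_set basis_arrow) : submodule T :=
  exist (fun U => is_submodule U) _ (coordinate_subspaces_submodule (valP A)).
(* By [coordinates], a submodule is recovered from the basis vectors it contains. *)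
have coordE L j v : (v \in coordinate_subspaces (basis_of_submodule L) j)
    = (v \in val L j).
  apply/coordinate_subspacesP/idP => [Lv | Lv m vm]; last first.
    by rewrite inE /=; apply: coordinates vm.
  rewrite [v]row_sum_delta; apply: memv_suml => m _.
  have [-> | /Lv] := eqVneq (v 0 m) 0; first by rewrite scale0r mem0v.
  by rewrite inE; apply: memvZ.
exists _, (closed_set basis_arrow : finDistrLatticeType _), f; split.
  exists g => [L | A]; apply: val_inj => /=.
    by apply/ffunP => j; apply/vspaceP => v; rewrite coordE.
  apply/setP => -[j m]; rewrite inE /=; apply/coordinate_subspacesP/idP.
    by apply; rewrite mxE !eqxx oner_eq0.
  by move=> Am n; rewrite mxE eqxx /=; case: (n =P m) => [-> | _] /eqP.
move=> L N; rewrite closed_leE /submodule_le.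
apply/subsetP/forallP => [LN j | LN p].
  apply/subvP => v; rewrite -!coordE => /coordinate_subspacesP Lv.
  by apply/coordinate_subspacesP => m /Lv /LN.
by rewrite !inE; apply/subvP/LN.
Qed.

End Submodules.

(** * Invariant subspaces of a nilpotent Jordan block *)

Section Jordan.
Variables (F : fieldType) (n : nat) (V : {vspace 'rV[F]_n}).
Let row_of (u : nat -> F) : 'rV[F]_n := \row_(m < n) u m.

(** If the last nonzero coordinate of a vector is the h-th, that of its shift is the one before.
    Induction then yields all earlier basis vectors, and subtracting their multiples isolates the
    h-th. *)
Lemma shift_closed_coordinates :
    (forall u : nat -> F, (forall m, (n <= m)%N -> u m = 0) ->
       row_of u \in V -> row_of (fun m => u m.+1) \in V) ->
  forall (v : 'rV[F]_n) m, v \in V -> v 0 m != 0 -> delta_mx 0 m \in V.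
Proof.
move=> shV; have rowE u l : row_of u 0 l = u l by rewrite mxE.
have top h u : (h <= n)%N -> (forall m, (h <= m)%N -> u m = 0) ->
    row_of u \in V -> forall (t : nat) (m : 'I_n), u t != 0 -> (m <= t)%N ->
    delta_mx 0 m \in V.
  elim: h u => [|h IHh] u lt_hn u0 Vu t m; first by rewrite u0 ?eqxx.
  have [uh0 | uh] := eqVneq (u h) 0.
    apply: IHh (ltnW lt_hn) _ Vu t m => l; rewrite leq_eqVlt => /predU1P[<- //|].
    exact: u0.
  have lower (l : 'I_n) : (l < h)%N -> delta_mx 0 l \in V.
    case: h lt_hn IHh u0 uh => // h lt_hn IHh u0 uh; rewrite ltnS => le_lh.
    apply: (IHh (fun m => u m.+1)) uh le_lh => [|l' le_hl|].
    - exact: ltnW.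
    - exact: u0.
    by apply: shV Vu => l' le_nl; apply: u0; apply: leq_trans le_nl.
  move=> ut /leq_trans le_mt.
  have {}/le_mt : (t <= h)%N.
    by rewrite leqNgt; apply: contraNN ut => lt_ht; rewrite u0.
  rewrite leq_eqVlt => /predU1P[mh | /lower //].
  have := Vu; rewrite [row_of u]row_sum_delta (bigD1 m) //= rowE mh.
  rewrite rpredDr; last first.
    apply: rpred_sum => l ne_lm; rewrite rowE.
    have [lt_lh | gt_lh | /esym eq_lh] := ltngtP l h.
    - by rewrite rpredZ ?lower.
    - by rewrite u0 ?scale0r ?mem0v.
    by case/eqP: ne_lm; apply: val_inj; rewrite /= mh eq_lh.
  by rewrite rpredZeq (negPf uh).
move=> v m Vv vm.
(* The extension of [v] by zero, as [top] works with sequences. *)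
pose u l := if insub l is Some l' then v 0 (l' : 'I_n) else 0.
have uE (l : 'I_n) : u l = v 0 l by rewrite /u valK.
apply: (top n u (leqnn n) _ _ m m _ (leqnn m)); last by rewrite uE.
  by move=> l le_nl; rewrite /u insubF // ltnNge le_nl.
by rewrite (_ : row_of u = v) //; apply/rowP => l; rewrite mxE uE.
Qed.

End Jordan.

(** * Darts, corners and regions of prime diagrams without curls *)

Section Diagram.
Variable K : link_diagram.

Lemma oppK (x : K) : opp (opp x) = x.
Proof. by case: K x => M /= _ H _ _ _ _ x; case: (H x). Qed.

Lemma opp_neq (x : K) : opp x != x.
Proof. by case: K x => M /= _ H _ _ _ _ x; case: (H x). Qed.

Lemma card_porbit_cw (x : K) : #|porbit cw x| = 4.
Proof. by case: K x. Qed.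

Lemma connected (x y : K) : connect adj x y.
Proof. by case: K x y. Qed.

Lemma cw4 (x : K) : cw (cw (cw (cw x))) = x.
Proof. by have := iter_porbit cw x; rewrite card_porbit_cw. Qed.

Lemma cw_uniq (x : K) : uniq [:: x; cw x; cw (cw x); cw (cw (cw x))].
Proof. by have := uniq_traject_porbit cw x; rewrite card_porbit_cw. Qed.

Lemma crossing_ofP (x y : K) : (crossing_of x == crossing_of y)
  = (x \in [:: y; cw y; cw (cw y); cw (cw (cw y))]).
Proof. by rewrite -val_eqE /= eq_porbit_mem porbit_traject card_porbit_cw. Qed.

Lemma crossing_of_cw (x : K) : crossing_of (cw x) = crossing_of x.
Proof. by apply/eqP; rewrite crossing_ofP !inE eqxx orbT. Qed.

Lemma segment_ofP (x y : K) :
  (segment_of x == segment_of y) = (x == y) || (x == opp y).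
Proof.
have card_opp : #|porbit opp y| = 2.
  have := iter_porbit opp y; have := uniq_traject_porbit opp y.
  have := porbit_traject opp y; have := porbit_id opp y.
  case: #|_| => [|[|[|n]]] yin eqs /=; rewrite ?oppK.
  - by rewrite eqs in yin.
  - by move=> _ /eqP; rewrite (negPf (opp_neq y)).
  - by [].
  by rewrite !inE eqxx !orbT.
by rewrite -val_eqE /= eq_porbit_mem porbit_traject card_opp !inE.
Qed.

Lemma segment_of_opp (x : K) : segment_of (opp x) = segment_of x.
Proof. by apply/eqP; rewrite segment_ofP eqxx orbT. Qed.

Lemma segment_of_surj (j : segment K) : exists x, j = segment_of x.
Proof. by have /imsetP[x _ eq_x] := valP j; exists x; apply: val_inj. Qed.

Lemma bndE (x : K) : cw (bnd x) = opp x.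
Proof. by rewrite /bnd permM permKV. Qed.

Lemma region_of_bnd (x : K) : region_of (bnd x) = region_of x.
Proof. by apply/val_inj/(porbit_perm bnd 1). Qed.

Lemma bnd_opp_cw (x : K) : bnd (opp (cw x)) = x.
Proof. by apply: (@perm_inj _ cw); rewrite bndE oppK. Qed.

Lemma region_of_opp (x : K) : region_of (opp (cw x)) = region_of x.
Proof. by rewrite -region_of_bnd bnd_opp_cw. Qed.

Lemma region_of_opp_cw (x : K) : region_of (opp x) = region_of (cw (cw (cw x))).
Proof. by rewrite -{1}(cw4 x) region_of_opp. Qed.

Section Prime.
Hypotheses (K_prime : prime_diagram K) (K_curls : without_curls K).

Lemma bnd_neq (x : K) : bnd x != x.
Proof.
apply: contra (K_curls (region_of x)) => /eqP fix_x; apply/eqP => /=.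
have : porbit bnd x =i [set x].
  move=> y; rewrite inE; apply/porbitP/eqP => [[n ->] | ->].
    by rewrite permX; elim: n => //= n ->.
  by exists 0%N; rewrite perm1.
by move/setP ->; rewrite cards1.
Qed.

(** Otherwise a curve crossing the segment of [cw x] twice in the same direction would violate
    primality. *)
Lemma region_of_cw_neq (x : K) : region_of (cw x) <> region_of x.
Proof.
move=> eqR; have: two_point_curve (cw x) (cw x) by split; rewrite region_of_opp.
by move/K_prime => /eqP; rewrite eq_sym (negPf (opp_neq _)).
Qed.

(** Otherwise there is a two-point curve through [cw x] and [cw (cw x)]; primality makes these the
    two ends of one segment, which closes a monogon. *)
Lemma region_of_cw2_neq (x : K) : region_of (cw (cw x)) <> region_of x.
Proof.
move=> eqR; have: two_point_curve (cw (cw x)) (cw x).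
  by split; rewrite region_of_opp.
move/K_prime => eq_opp; case/eqP: (bnd_neq (cw x)).
by apply: (@perm_inj _ cw); rewrite bndE {1}eq_opp oppK.
Qed.

Definition corner (x : K) : marker K := (crossing_of x, region_of x).

Lemma corner_inj : injective corner.
Proof.
move=> x y eq_c; have eqR : region_of x = region_of y := congr1 snd eq_c.
have /eqP := congr1 fst eq_c; rewrite /= crossing_ofP !inE.
case/or4P => /eqP eq_x //; move: eqR; rewrite eq_x.
- by move/region_of_cw_neq.
- by move/region_of_cw2_neq.
by rewrite -{2}(cw4 y) => /esym/region_of_cw_neq.
Qed.

Lemma opp_crossing_neq (x : K) : crossing_of (opp x) != crossing_of x.
Proof.
apply/negP; rewrite crossing_ofP !inE.
case/or4P => /eqP eq_opp.
- by have := opp_neq x; rewrite eq_opp eqxx.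
- by case/eqP: (bnd_neq x); apply: (@perm_inj _ cw); rewrite bndE.
- have /esym := region_of_opp_cw x; rewrite eq_opp.
  exact: region_of_cw_neq.
case/eqP: (bnd_neq (cw (cw (cw x)))); apply: (@perm_inj _ cw).
by rewrite bndE cw4 -eq_opp oppK.
Qed.

(** As no segment is a loop, a 2-cycle must close up through the far ends of both segments, around a
    bigon. *)
Lemma on_two_cycle_bigon (x : K) : on_two_cycle x -> bnd (bnd x) = x.
Proof.
case/existsP=> y; rewrite !segment_ofP => /andP[/orP[]/eqP-> /orP[]/eqP eq_x].
- by have := cw_uniq x; rewrite eq_x /= !inE eqxx !orbT.
- have := opp_crossing_neq x.
  by rewrite -eq_x !crossing_of_cw eqxx.
- have := opp_crossing_neq (cw x).
  by rewrite -(crossing_of_cw (opp _)) eq_x crossing_of_cw eqxx.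
by rewrite -{2}(bnd_opp_cw x) -(bnd_opp_cw (opp (cw x))) eq_x oppK.
Qed.

Lemma connected_ind (P : pred K) (x : K) :
    P x -> (forall y : K, P y -> P (cw y)) -> (forall y : K, P y -> P (opp y)) ->
  forall y, P y.
Proof.
move=> Px Pcw Popp y; have /connectP[p] := connected x y.
elim: p x Px => [|z p IHp] x Px /=; first by move=> _ ->.
by case/andP=> /orP[] /eqP ->; apply: IHp; auto.
Qed.

(* A two-point curve crosses the remaining segments at the two ends of x, so  *)
(* that the diagram is the standard one of the Hopf link.                     *)
Lemma two_bigons_segments (x : K) :
    bnd (bnd x) = x -> bnd (bnd (opp x)) = opp x ->
  forall y, segment_of y \in
    [:: segment_of x; segment_of (cw x); segment_of (cw (cw x));
        segment_of (cw (cw (cw x)))].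
Proof.
move=> bigon_x bigon_ox.
have bigonE (z : K) : bnd (bnd z) = z -> opp (cw z) = cw (cw (cw (opp z))).
  by move=> bigon_z; rewrite -{1}bigon_z bndE oppK -bndE cw4.
have e1 := bigonE x bigon_x.
have e3 : opp (cw (cw (cw x))) = cw (opp x).
  by rewrite -{1}(oppK x) -bigonE ?oppK.
have e2 : opp (cw (cw x)) = cw (cw (opp x)).
  apply/esym/K_prime; split; rewrite region_of_opp.
    by rewrite -[RHS]region_of_opp -e1 oppK.
  by rewrite -e3 region_of_opp.
have inE4 (y : K) k : (k < 4)%N -> y = iter k cw x \/ y = opp (iter k cw x) ->
    segment_of y \in [:: segment_of x; segment_of (cw x); segment_of (cw (cw x));
        segment_of (cw (cw (cw x)))].
  by case: k => [|[|[|[|]]]] //= _ [] ->; rewrite ?segment_of_opp !inE eqxx ?orbT.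
apply: (connected_ind (x := x)) => [|y Py|y]; last by rewrite segment_of_opp.
  by rewrite inE eqxx.
rewrite !inE !segment_ofP -!orbA e1 e2 e3 in Py.
case/or4P: Py => [||| /or4P[|||/orP[]]] /eqP ->; rewrite ?cw4.
- by apply: (inE4 _ 1%N) => //; left.
- by apply: (inE4 _ 3%N) => //; right.
- by apply: (inE4 _ 2%N) => //; left.
- by apply: (inE4 _ 0%N) => //; right.
- by apply: (inE4 _ 3%N) => //; left.
- by apply: (inE4 _ 1%N) => //; right.
- by apply: (inE4 _ 0%N) => //; left.
by apply: (inE4 _ 2%N) => //; right.
Qed.

(** * Kauffman states and transposition counts *)

Section States.
Variable i : segment K.

Lemma adjacent_segment (x : K) : adjacent (segment_of x) (region_of x).
Proof. by apply/existsP; exists x; rewrite !eqxx. Qed.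

Lemma adjacent_segment_cw (x : K) : adjacent (segment_of (cw x)) (region_of x).
Proof. by rewrite -segment_of_opp -region_of_opp adjacent_segment. Qed.

Lemma state_adjacent (S : {set marker K}) (x : K) :
  kauffman_state i S -> adjacent i (region_of x) -> corner x \notin S.
Proof.
case/and3P=> _ _ /forallP/(_ (region_of x))/eqP + adj_x; rewrite adj_x => /eqP.
by rewrite cards_eq0 => /eqP/setP/(_ (corner x)); rewrite !inE eqxx andbT => ->.
Qed.

(** Injectivity of [corner] turns the count of markers of a region into a count of darts on its
    boundary. *)
Lemma state_region (S : {set marker K}) (x : K) :
    kauffman_state i S -> ~~ adjacent i (region_of x) ->
  #|[set y in porbit bnd x | corner y \in S]| = 1%N.
Proof.
case/and3P=> /forall_inP incS _ /forallP/(_ (region_of x))/eqP + adj_x.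
rewrite adj_x => eq1; rewrite -(card_imset _ corner_inj) -[RHS]eq1.
congr #|pred_of_set _|.
apply/setP => -[c R]; rewrite inE /=; apply/imsetP/andP => [[y] | [Sm /eqP eqR]].
  rewrite inE => /andP[xy Sy] [-> ->]; split=> //.
  by rewrite -val_eqE /= eq_porbit_mem.
have /existsP[y /andP[/eqP /= yc /eqP /= yR]] := incS _ Sm.
have eq_m : (c, R) = corner y by rewrite -yc -yR.
exists y => //; rewrite inE -eq_m Sm andbT -eq_porbit_mem.
by rewrite -[_ == _]/(region_of y == region_of x) yR eqR.
Qed.

(* The marker leaves the corner on the clockwise side of segment j for the    *)
(* one on its counterclockwise side.                                          *)
Lemma transposition_corner j (S S' : {set marker K}) (x : K) :
    ccw_transposition i j S S' ->
  ((corner x \in S) + (segment_of (cw x) == j)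
     = (corner x \in S') + (segment_of x == j))%N.
Proof.
case=> _ [_ [a /= [<- [Sa Soa] [S'a S'oa] /setP/(_ (corner x))]]].
(* The corner counterclockwise of a dart is named by the dart preceding it. *)
have eq1 : (crossing_of a, region_of (opp a)) = corner (cw (cw (cw a))).
  by rewrite region_of_opp_cw /corner !crossing_of_cw.
have eq2 : (crossing_of (opp a), region_of a) = corner (cw (cw (cw (opp a)))).
  by rewrite -{2}(oppK a) region_of_opp_cw /corner !crossing_of_cw.
have eq_cw (y : K) : (corner x == corner (cw (cw (cw y)))) = (cw x == y).
  by rewrite (inj_eq corner_inj) -(inj_eq (@perm_inj _ cw)) cw4.
move: S'a S'oa; rewrite eq1 eq2 => S'a S'oa.
rewrite !inE !eq_cw -!segment_ofP.
rewrite -[(crossing_of a, _)]/(corner a).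
rewrite -[(_, region_of (opp a))]/(corner (opp a)).
rewrite !(inj_eq corner_inj) -!segment_ofP.
have Sx : segment_of x == segment_of a -> corner x \in S.
  by rewrite segment_ofP => /orP[] /eqP ->.
have S'x : segment_of (cw x) == segment_of a -> corner x \in S'.
  by rewrite segment_ofP -!eq_cw => /orP[] /eqP ->.
case: (segment_of x == _) Sx => [/(_ isT) ->|_];
case: (segment_of (cw x) == _) S'x => [/(_ isT) ->|_] /=;
  by do ?case: (corner x \in _).
Qed.

(** [transposition_corner] telescopes; adding on both sides avoids truncated subtraction. *)
Lemma sequence_corner w (S S' : {set marker K}) (x : K) :
    ccw_sequence i S w S' ->
  ((corner x \in S) + count_mem (segment_of (cw x)) w
     = (corner x \in S') + count_mem (segment_of x) w)%N.
Proof.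
elim: w S => [|j w IHw] S /=; first by move=> ->.
case=> S1 /(transposition_corner x) eq1 /IHw eqw.
by rewrite addnA (eq_sym j) eq1 addnAC eqw addnAC -addnA (eq_sym j).
Qed.

(** A transposition at [i] would need a marker in a region adjacent to [i]. *)
Lemma sequence_count_i w (S S' : {set marker K}) :
  ccw_sequence i S w S' -> count_mem i w = 0%N.
Proof.
elim: w S => [|j w IHw] S //= [S1 + /IHw ->]; rewrite addn0.
case=> St [_ [a /= [<- [Sa _] _ _]]]; apply/eqP; rewrite eqb0.
apply: contraL Sa => /eqP eq_i; apply: (state_adjacent (x := a)) St _.
by rewrite -eq_i adjacent_segment.
Qed.

Variables (Smin Smax : {set marker K}) (w : seq (segment K)).
Hypothesis Smin_state : kauffman_state i Smin.
Hypothesis Smax_state : kauffman_state i Smax.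
Hypothesis w_seq : ccw_sequence i Smin w Smax.
Let d (j : segment K) := count_mem j w.

(* A region adjacent to i never carries a marker, so the number of            *)
(* transpositions is constant along its boundary.                             *)
Lemma count_adjacent_i (x : K) :
  adjacent i (region_of x) -> d (segment_of x) = 0%N.
Proof.
move=> adj_x; have /existsP[a /andP[/eqP seg_a /eqP/esym eqR]] := adj_x.
have: x \in porbit bnd a.
  by rewrite -eq_porbit_mem -[_ == _]/(region_of x == region_of a) eqR.
case/porbitP=> n eq_x; rewrite {}eq_x in adj_x eqR *.
have {adj_x eqR} adj_R k : adjacent i (region_of ((bnd ^+ k)%g a)).
  have -> : region_of ((bnd ^+ k)%g a) = region_of a.
    by apply/val_inj/(porbit_perm bnd k).
  by rewrite -eqR.
elim: n => [|n IHn]; first by rewrite perm1 seg_a; apply: sequence_count_i w_seq.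
have := sequence_corner ((bnd ^+ n.+1)%g a) w_seq.
rewrite !(negPf (state_adjacent _ (adj_R _))) // !add0n /d => <-.
by rewrite expgSr permM bndE segment_of_opp.
Qed.

(** If the two dimensions differ, [sequence_corner] decides whether the corner lies in [Smin]. *)
Lemma shiftE (x : K) : shift Smin d x = (corner x \in Smin).
Proof.
have := sequence_corner x w_seq; rewrite /shift -/(corner x) /d.
case: (corner x \in Smin); case: (corner x \in Smax); case: eqP => [|?];
  by [lia | case: eqP; lia].
Qed.

(** By [two_bigons_segments], [i] borders a region of the segment of [x] unless it is opposite to
    [x] at the crossing point. In that case the segment of [cw x] has count zero, and counts of
    consecutive segments differ by at most one. *)
Lemma two_bigons_count (x : K) :
  bnd (bnd x) = x -> bnd (bnd (opp x)) = opp x -> (d (segment_of x) <= 1)%N.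
Proof.
move=> bigon_x bigon_ox.
have [y eq_i] := segment_of_surj i.
have := two_bigons_segments bigon_x bigon_ox y; rewrite -eq_i !inE.
case/or4P => /eqP seg_i.
- by rewrite count_adjacent_i // seg_i adjacent_segment.
- by rewrite count_adjacent_i // seg_i adjacent_segment_cw.
- have cw0 : d (segment_of (cw x)) = 0%N.
    by rewrite count_adjacent_i // seg_i adjacent_segment_cw.
  have := sequence_corner x w_seq; rewrite -!/(d _) cw0; lia.
rewrite -segment_of_opp count_adjacent_i // seg_i region_of_opp_cw.
exact: adjacent_segment.
Qed.

(** * The Jordan block obtained by walking around a region *)

Variable F : fieldType.
Let T := kauffman_module F Smin d.
Implicit Type L : submodule T.

(* Coordinates are indexed by nat, so that no cast is needed between the      *)
(* spaces at equal segments.                                                  *)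
Definition in_submodule L (j : segment K) (u : nat -> F) : Prop :=
  (\row_(m < rdim T j) u m \in val L j) /\
  forall m, (d j <= m)%N -> u m = 0.

Lemma eq_in_submodule L (j : segment K) u u' :
  u =1 u' -> in_submodule L j u -> in_submodule L j u'.
Proof.
move=> eq_u [Lu u0]; split=> [|m /u0]; last by rewrite -eq_u.
have <- // : \row_(m < rdim T j) u m = \row_(m < rdim T j) u' m.
by apply/rowP => m; rewrite !mxE eq_u.
Qed.

Lemma in_submodule_arrow L (x : K) u :
    ~~ on_two_cycle x -> in_submodule L (segment_of x) u ->
  in_submodule L (segment_of (cw x)) (fun m => u (m + (corner x \in Smin)))%N.
Proof.
move=> x_arr [Lu u0]; split=> [|m le_dm]; last first.
  (* By [sequence_corner] the source dimension is at most the target dimension plus the marker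
     bit. *)
  apply: u0; rewrite addnC; apply: leq_trans (leq_add (leqnn _) le_dm).
  by rewrite [leqRHS](sequence_corner x w_seq) leq_addl.
pose a : arrow (diagram_quiver K) :=
  exist (fun y : K => ~~ on_two_cycle y) x x_arr.
have <- : \row_(m < rdim T (source a)) u m *m rmap T a
    = \row_(m < rdim T (target a)) u (m + (corner x \in Smin))%N.
  2: exact: (submodule_map (a := a)).
apply/rowP => n; rewrite !mxE /= -shiftE.
have [lt_n | le_n] := ltnP (n + shift Smin d x) (d (segment_of x)).
  rewrite (bigD1 (Ordinal lt_n)) //= !mxE eqxx mulr1 big1 ?addr0 // => m ne_m.
  rewrite !mxE; case: eqP => [eq_m|]; last by rewrite mulr0.
  by case/eqP: ne_m; apply: val_inj.
rewrite u0 // big1 // => m _; rewrite !mxE.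
case: eqP => [eq_m|]; last by rewrite mulr0.
by move: le_n; rewrite -eq_m leqNgt ltn_ord.
Qed.

(** The arrow of a corner y leads to the segment of [bnd^-1 y], so the boundary is walked backwards.
    The marker bits met on a full turn add up to one, and no arrow is missing because the region is
    not a bigon. *)
Lemma in_submodule_region L (x : K) u :
    ~~ adjacent i (region_of x) -> bnd (bnd x) != x ->
    in_submodule L (segment_of x) u ->
  in_submodule L (segment_of x) (fun m => u m.+1).
Proof.
move=> adj_x bigon_x Lu.
have walk n (y : K) v : bnd (bnd y) != y -> in_submodule L (segment_of y) v ->
    in_submodule L (segment_of (iter n (bnd^-1)%g y))
      (fun m => v (m + count (fun z => corner z \in Smin)
                              (traject (bnd^-1)%g y n)))%N.
  elim: n y v => [|n IHn] y v bigon_y Ly.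
    by apply: eq_in_submodule Ly => m; rewrite addn0.
  rewrite iterSr; have eq_y : bnd^-1%g y = opp (cw y).
    by apply: (@perm_inj _ bnd); rewrite permKV bnd_opp_cw.
  have {}Ly : in_submodule L (segment_of (bnd^-1%g y))
      (fun m => v (m + (corner y \in Smin)))%N.
    rewrite eq_y segment_of_opp; apply: in_submodule_arrow Ly.
    by apply: contraNN bigon_y => /on_two_cycle_bigon ->.
  apply: eq_in_submodule (IHn _ _ _ Ly) => [m|] /=.
    by rewrite -addnA [(count _ _ + _)%N]addnC.
  by rewrite permKV; apply: contraNN bigon_y => /eqP ->; rewrite permKV.
have := walk #|porbit (bnd^-1)%g x| x u bigon_x Lu; rewrite iter_porbit.
apply: eq_in_submodule => m; rewrite -addn1; congr (u (m + _)%N).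
rewrite -(state_region Smin_state adj_x) -size_filter.
rewrite -(card_uniqP (filter_uniq _ (uniq_traject_porbit _ _))).
by apply: eq_card => y; rewrite mem_filter !inE -porbit_traject porbitV andbC.
Qed.

Lemma kauffman_module_coordinates L (j : segment K) (v : 'rV_(rdim T j)) m :
  v \in val L j -> v 0 m != 0 -> delta_mx 0 m \in val L j.
Proof.
apply: shift_closed_coordinates => u u0 Lu.
have [le_dj1 | lt1_dj] := leqP (d j) 1.
  rewrite (_ : \row__ _ = 0) ?mem0v //; apply/rowP => l; rewrite !mxE.
  by rewrite u0 // (leq_trans le_dj1).
have [x eq_j] := segment_of_surj j; rewrite {j}eq_j in v m u0 Lu lt1_dj *.
have [] : in_submodule L (segment_of x) (fun m => u m.+1); last by [].
have not_adj y : segment_of y = segment_of x -> ~~ adjacent i (region_of y).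
  move=> eq_seg; apply: contraTN lt1_dj => /count_adjacent_i.
  by rewrite eq_seg => ->.
have {u0 Lu} Lu : in_submodule L (segment_of x) u by split.
(* The walk uses whichever of the two regions of the segment is not a bigon. *)
have [bigon_x | not_bigon] := eqVneq (bnd (bnd x)) x; last first.
  by apply: in_submodule_region not_bigon Lu; apply: not_adj.
have [bigon_ox | not_bigon] := eqVneq (bnd (bnd (opp x))) (opp x).
  by rewrite ltnNge two_bigons_count in lt1_dj.
rewrite -segment_of_opp in Lu *; apply: in_submodule_region not_bigon Lu.
by apply: not_adj; rewrite segment_of_opp.
Qed.

End States.
End Prime.
End Diagram.

Theorem theorem1p1 (K : link_diagram)
    (K_prime : prime_link_diagram K) (K_curls : without_curls K)
    (i : segment K) (k : closedFieldType)
    (Smin Smax : {set marker K})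
    (Smin_min : minimal_state i Smin) (Smax_max : maximal_state i Smax)
    (w : seq (segment K)) (w_seq : ccw_sequence i Smin w Smax) :
  let d (j : segment K) := count_mem j w in
  let T := kauffman_module k Smin d in
  finite_distributive_lattice (@submodule_le k (diagram_quiver K) T).
Proof.
apply: submodules_distributive => L j v m.
exact: (kauffman_module_coordinates
  K_prime.2 K_curls Smin_min.1 Smax_max.1 w_seq).
Qed.
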